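(* Let $n\ge 3$ and $G\cong PO_n^{+,+}(3)$, with $D$ its class of reflections. Then $\varphi(G)=n$ if $n\equiv 1 \pmod 3$, and $\varphi(G)=n+1$ otherwise.
   Context: Let $V$ be the $n$-dimensional orthogonal space over $\mathbb F_3$ with nondegenerate symmetric bilinear form $(\cdot,\cdot)$ whose Gram matrix (in some, equivalently any, basis) has determinant $1$, and let $Q(v)=2(v,v)=-(v,v)$. $O_n^{+,+}(3)$ is the subgroup of the isometry group of $V$ generated by the reflections $t(v)$ in vectors $v$ with $Q(v)=1$ (equivalently $(v,v)=-1$), $PO_n^{+,+}(3)$ is its image modulo the scalars $\pm 1$, and $D$ is the image of the set of these reflections. $\varphi(G)$ denotes the maximal integer $m$ for which there is an injective homomorphism $S_m\to G$ sending every transposition $(i\,j)$ into $D$. *)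

(* Defs.v *)
From HB Require Import structures.
From mathcomp Require Import all_boot all_order all_algebra all_fingroup.
From mathcomp Require Import ring.

Set Implicit Arguments.
Unset Strict Implicit.
Unset Printing Implicit Defensive.

Import GRing.Theory.
Local Open Scope ring_scope.

Section OrthogonalSpace.

Variables (n : nat) (b : {symmetric 'rV['F_3]_n}).

Implicit Types u v w : 'rV['F_3]_n.

Definition quadf v : 'F_3 := 2 * b v v.

(* When b v v = 0 the convention x / 0 = 0 makes this the identity, so it is
   an involution for every v. *)
Definition refl_fun v u := u - (2 * b u v / b v v) *: v.

Lemma refl_funK v : involutive (refl_fun v).
Proof.
move=> u; rewrite /refl_fun.
have [bv0|bvn0] := eqVneq (b v v) 0.
  by rewrite bv0 !invr0 !mulr0 !scale0r !subr0.
rewrite linearBl linearZl_LR /= -addrA -opprD -scalerDl.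
suff -> : 2 * b u v / b v v
          + 2 * (b u v - 2 * b u v / b v v * b v v) / b v v = 0.
  by rewrite scale0r subr0.
by field.
Qed.

Lemma refl_fun_linear v : linear (refl_fun v).
Proof.
move=> a u w; rewrite /refl_fun linearPl /= scalerBr scalerA addrACA -opprD.
by rewrite -scalerDl; congr (_ - _ *: _); ring.
Qed.

Lemma refl_fun_isometry v u w : b (refl_fun v u) (refl_fun v w) = b u w.
Proof.
have bC x y : b x y = b y x by rewrite [LHS]hermC /= expr0 mul1r.
rewrite /refl_fun; have [bv0|bvn0] := eqVneq (b v v) 0.
  by rewrite bv0 !invr0 !mulr0 !scale0r !subr0.
rewrite linearBl /= !linearBr /= !linearZl_LR /= !linearZr_LR /=.
by rewrite (bC v w); field.
Qed.

Definition reflection v : {perm 'rV['F_3]_n} := perm (inv_inj (refl_funK v)).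

Definition reflections : {set {perm 'rV['F_3]_n}} :=
  [set reflection v | v in [pred v | quadf v == 1]].

(* This is O_n^{+,+}(3) when the Gram determinant of b is 1; it consists of
   permutations of the vectors, so as to live in a finGroupType for every n. *)
Definition Opp : {group {perm 'rV['F_3]_n}} := <<reflections>>%G.

End OrthogonalSpace.

Definition scalars n : {group {perm 'rV['F_3]_n}} :=
  <[perm (@oppr_inj 'rV['F_3]_n)]>%G.

(* A quotient A / H is the image of A :&: 'N(H); scalars commute with every
   linear map, so nothing is lost here. *)
Lemma Opp_norm_scalars n (b : {symmetric 'rV['F_3]_n}) :
  (Opp b \subset 'N(scalars n))%g.
Proof.
apply: subset_trans (cent_sub _); rewrite gen_subG /= cent_cycle.
apply/subsetP=> _ /imsetP[v _ ->]; apply/cent1P/permP=> u.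
rewrite !permM !permE /=.
have /= := refl_fun_linear b v (-1) u 0.
by rewrite !scaleN1r !addr0 {3}/refl_fun linear0l /= mulr0 mul0r scale0r subr0 addr0.
Qed.

Definition POpp n (b : {symmetric 'rV['F_3]_n}) :
  {group coset_of (scalars n)} := (Opp b / scalars n)%G.

Definition Preflections n (b : {symmetric 'rV['F_3]_n}) :
  {set coset_of (scalars n)} := (reflections b / scalars n)%g.

Definition transposition_embedding (gT : finGroupType) (G : {group gT})
    (D : {set gT}) (m : nat) : Prop :=
  exists f : {morphism [set: 'S_m] >-> gT},
    [/\ ('injm f)%g, (f @* [set: 'S_m] \subset G)%g
      & forall i j : 'I_m, i != j -> f (tperm i j) \in D].

(* The partial function phi as a relation: phi(G) = k, relative to D. *)
Definition is_phi (gT : finGroupType) (G : {group gT}) (D : {set gT})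
    (k : nat) : Prop :=
  transposition_embedding G D k /\
  forall m : nat, transposition_embedding G D m -> (m <= k)%N.

(* Main.v *)
(* If S_m embeds, the images of the transpositions (i i+1) are reflections in
   vectors v_i of norm -1 = 2 with (v_i, v_(i+1)) = 1 or -1 and (v_i, v_j) = 0
   for i + 1 < j, so the Gram determinant of v_1, ..., v_k is k + 1. On the other
   hand it is a square if k = n, and 0 if k = n + 1; this bounds m.
   Conversely, V has an orthonormal basis e_1, ..., e_n, and S_n acts by
   permuting it, (i j) being the reflection in e_i - e_j. If n = 0 or 2 mod 3,
   put c = 1 or -1 respectively and e_0 = c (e_1 + ... + e_n): the reflections in
   the differences e_i - e_j with 0 <= i < j <= n generate S_(n+1), which permutes
   the points e_i up to translations: s maps e_k to e_(s k) + c (e_(s 0) - e_0). *)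
Require Import Defs.
From HB Require Import structures.
From mathcomp Require Import all_boot all_order all_algebra all_fingroup.
From mathcomp Require Import ring zify.

Set Implicit Arguments.
Unset Strict Implicit.
Unset Printing Implicit Defensive.

Import GRing.Theory.
Local Open Scope ring_scope.

(** * Determinants of tridiagonal matrices *)

(** Expansion along the first row, then the first column, gives the recurrence d_(k+2) = 2 d_(k+1) -
    d_k: off-diagonal entries enter only through the products [A i j * A j i]. *)
Lemma det_tridiag (R : comPzRingType) k (A : 'M[R]_k) :
    (forall i, A i i = 2%:R) ->
    (forall i j : 'I_k, j = i.+1 :> nat -> A i j * A j i = 1) ->
    (forall i j : 'I_k, (i.+1 < j)%N -> A i j = 0 /\ A j i = 0) ->
  \det A = k.+1%:R.
Proof.
have [N] := ubnP k; elim: N k A => // N IH [|[|k]] A /ltnSE-ltkN A_diag A_adj A_far.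
- by rewrite det_mx00.
- by rewrite det_mx11 A_diag.
rewrite (expand_det_row _ ord0) 2!big_ord_recl big1 => [|j _]; last first.
  by rewrite (A_far _ _ _).1 ?mul0r.
rewrite addr0 A_diag /cofactor expr0 mul1r.
set A' := row' _ (col' _ A); set j1 := lift ord0 ord0.
have entryA' i j : A' i j = A (lift ord0 i) (lift ord0 j) by rewrite !mxE.
have -> : \det A' = k.+2%:R.
  apply: IH => // [i|i j eq_ji|i j lt_ij]; rewrite !entryA' ?A_diag //.
    by apply: A_adj; rewrite !lift0 eq_ji.
  by apply: A_far; rewrite !lift0.
set B := row' _ (col' _ A); rewrite expr1 mulN1r.
have liftj1 (j : 'I_k) : lift j1 (lift ord0 j) = lift ord0 (lift ord0 j).
  by apply: val_inj.
rewrite (expand_det_col _ ord0) big_ord_recl big1 => [|j _]; last first.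
  rewrite !mxE (_ : lift j1 ord0 = ord0); last exact: val_inj.
  by rewrite (A_far _ _ _).2 ?mul0r.
rewrite addr0 /cofactor expr0 mul1r !mxE.
rewrite (_ : lift j1 ord0 = ord0); last exact: val_inj.
set C := row' _ (col' _ B).
have entryC i j : C i j = A (lift ord0 (lift ord0 i)) (lift ord0 (lift ord0 j)).
  by rewrite !mxE liftj1.
have -> : \det C = k.+1%:R.
  apply: IH => [|i|i j eq_ji|i j lt_ij]; rewrite ?entryC ?A_diag //.
  - exact: ltnW.
  - by apply: A_adj; rewrite !lift0 eq_ji.
  - by apply: A_far; rewrite !lift0.
rewrite mulrN mulrA A_adj // mul1r.
by rewrite -!natrM -natrB; [congr (_%:R); lia | lia].
Qed.

(** * Gram matrices, orthogonal complements and orthonormal bases *)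

Lemma gramE (R : comPzRingType) n k l (M : 'M[R]_n) (A : 'M_(k, n))
    (B : 'M_(l, n)) i j :
  (A *m M *m B^T) i j = (row i A *m M *m (row j B)^T) 0 0.
Proof. by rewrite -row_mul !mxE; apply: eq_bigr => p _; rewrite !mxE. Qed.

Lemma trmx_gram (R : comPzRingType) n k l (M : 'M[R]_n) (A : 'M_(k, n))
    (B : 'M_(l, n)) :
  M^T = M -> (A *m M *m B^T)^T = B *m M *m A^T.
Proof. by move=> symM; rewrite !trmx_mul trmxK symM mulmxA. Qed.

Lemma gram_sym0 (R : comPzRingType) n k l (M : 'M[R]_n) (A : 'M_(k, n))
    (B : 'M_(l, n)) :
  M^T = M -> B *m M *m A^T = 0 -> A *m M *m B^T = 0.
Proof. by move=> symM BA0; rewrite -(trmx_gram B A symM) BA0 trmx0. Qed.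

(** Otherwise the form vanishes on the complement [K] of the rows of [E], by polarization. As [K] is
    also orthogonal to the rows of [E], it is orthogonal to the whole space, although [M] is
    invertible and [K] is nonzero. *)
Lemma exists_orthogonal_nonisotropic (F : finFieldType) n k (M : 'M[F]_n)
    (E : 'M[F]_(k, n)) :
    2%:R != 0 :> F -> M^T = M -> M \in unitmx -> E *m M *m E^T \in unitmx ->
    (k < n)%N ->
  exists y : 'rV_n, E *m M *m y^T = 0 /\ (y *m M *m y^T) 0 0 != 0.
Proof.
move=> two_neq0 symM unitM unitG lt_kn.
pose K := kermx (M *m E^T); set G := E *m M *m E^T in unitG.
have K_neq0 : K != 0.
  rewrite -mxrank_eq0 mxrank_ker subn_eq0 -ltnNge.
  by rewrite (leq_ltn_trans (rank_leq_col _)).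
have KME : K *m M *m E^T = 0 by rewrite -mulmxA mulmx_ker.
case: (altP (@existsP _ [pred y : 'rV[F]_n |
    (y *m M *m E^T == 0) && ((y *m M *m y^T) 0 0 != 0)])) => [[y]|].
  by case/andP=> /eqP/(gram_sym0 symM) yE y_neq0; exists y.
rewrite negb_exists => /forallP all_isotropic.
have isotropic (y : 'rV_n) : y *m M *m E^T = 0 -> (y *m M *m y^T) 0 0 = 0.
  by move=> yE; have := all_isotropic y; rewrite /= yE eqxx /= negbK => /eqP.
have rowKE i : row i K *m M *m E^T = 0 by rewrite -!row_mul KME row0.
have KMK : K *m M *m K^T = 0.
  apply/matrixP=> i j; rewrite [RHS]mxE.
  have sym : (K *m M *m K^T) j i = (K *m M *m K^T) i j.
    by rewrite -[in LHS](trmx_gram K K symM) mxE.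
  have mxD (X Y : 'M[F]_1) : (X + Y) 0 0 = X 0 0 + Y 0 0 by rewrite mxE.
  have := isotropic (row i K + row j K).
  rewrite !mulmxDl !rowKE addr0 linearD /= !mulmxDr !mxD !isotropic //.
  rewrite -!gramE sym add0r addr0 => /(_ erefl)/eqP.
  by rewrite -mulr2n -mulr_natl mulf_eq0 (negPf two_neq0) => /eqP.
(* Right multiplication by [P] is the orthogonal projection onto the complement of the rows of
   [E]. *)
pose P := 1%:M - M *m E^T *m invmx G *m E.
have /submxP[D defP] : (P <= K)%MS.
  apply/sub_kermxP; rewrite mulmxBl mul1mx -!mulmxA [E *m (_ *m _)]mulmxA.
  by rewrite mulVmx // mulmx1 subrr.
have: K *m M *m P^T = 0 by rewrite defP trmx_mul mulmxA KMK mul0mx.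
rewrite linearB /= trmx1 mulmxBr mulmx1 !trmx_mul trmxK symM !mulmxA KME.
rewrite !mul0mx subr0 => /(congr1 (mulmx^~ (invmx M))).
by rewrite mulmxK // mul0mx => K0; rewrite K0 eqxx in K_neq0.
Qed.

Lemma F3_cases (x : 'F_3) : [\/ x = 0, x = 1 | x = -1].
Proof.
case: x => [[|[|[|//]]] ltx];
  by [apply: Or31; apply: val_inj | apply: Or32; apply: val_inj
     | apply: Or33; apply: val_inj].
Qed.

Lemma F3_sqr1 (x : 'F_3) : x != 0 -> x * x = 1.
Proof. by case: (F3_cases x) => ->; rewrite ?eqxx ?mulrNN ?mulr1. Qed.

Lemma gram_col_mx n k l (M : 'M['F_3]_n) (A : 'M_(k, n)) (B : 'M_(l, n)) :
    M^T = M -> B *m M *m A^T = 0 ->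
  col_mx A B *m M *m (col_mx A B)^T
    = block_mx (A *m M *m A^T) 0 0 (B *m M *m B^T).
Proof.
move=> symM BA0; rewrite mul_col_mx tr_col_mx mul_col_row BA0.
by rewrite (gram_sym0 symM BA0).
Qed.

(* Two orthogonal vectors of norm -1 span a plane that contains a vector of
   norm 1, so that only the last step of Gram-Schmidt can be obstructed. *)
Lemma exists_orthogonal_unit n k (M : 'M['F_3]_n) (E : 'M_(k, n)) :
    M^T = M -> M \in unitmx -> E *m M *m E^T = 1%:M -> (k.+1 < n)%N ->
  exists y : 'rV_n, E *m M *m y^T = 0 /\ y *m M *m y^T = 1%:M.
Proof.
move=> symM unitM orthoE lt_kn.
have [||x [Ex x_neq0]] := exists_orthogonal_nonisotropic (E := E) isT symM unitM.
- by rewrite orthoE unitmx1.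
- exact: ltnW.
have norm1 (y : 'rV_n) : (y *m M *m y^T) 0 0 = 1 -> y *m M *m y^T = 1%:M.
  by move=> y1; rewrite [LHS]mx11_scalar y1.
case: (F3_cases ((x *m M *m x^T) 0 0)) x_neq0 => [->|/norm1|xN1 _]; first by [].
  by exists x.
have [||y [/eqP]] := exists_orthogonal_nonisotropic (E := col_mx E x) isT symM unitM.
- rewrite gram_col_mx // ?orthoE; last exact: gram_sym0.
  by rewrite unitmxE det_ublock det1 mul1r [_ *m _]mx11_scalar det_scalar1 xN1.
- by rewrite addn1.
rewrite !mul_col_mx col_mx_eq0 => /andP[/eqP Ey /eqP xy] y_neq0.
have yx : y *m M *m x^T = 0 by exact: gram_sym0.
case: (F3_cases ((y *m M *m y^T) 0 0)) y_neq0 => [->|/norm1|yN1 _]; first by [].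
  by exists y.
exists (x + y); split; first by rewrite linearD mulmxDr Ex Ey addr0.
apply: norm1; rewrite linearD /= !mulmxDr !mulmxDl xy yx add0r addr0.
by rewrite mxE xN1 yN1; apply/eqP.
Qed.

(** Unit vectors can be chosen up to the last one, whose norm is then forced to be 1: since
    [\det M = 1] it equals the square of [\det P], and 1 is the only nonzero square in F_3. *)
Lemma orthonormal_matrix n (M : 'M['F_3]_n) :
  M^T = M -> \det M = 1 -> exists P : 'M_n, P *m M *m P^T = 1%:M.
Proof.
move=> symM detM; have unitM : M \in unitmx by rewrite unitmxE detM unitr1.
case: n => [|n] in M symM detM unitM *.
  by exists 0; apply/matrixP=> [[]].
have partial k : (k <= n)%N -> exists E : 'M_(k, n.+1), E *m M *m E^T = 1%:M.
  elim: k => [|k IH] lt_kn; first by exists 0; apply/matrixP=> [[]].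
  have [E orthoE] := IH (ltnW lt_kn).
  have [//|y [Ey y1]] := exists_orthogonal_unit symM unitM orthoE.
  exists (col_mx y E); rewrite (gram_col_mx (A := y) (B := E)) // y1 orthoE.
  by rewrite -scalar_mx_block.
have [E orthoE] := partial n (leqnn n).
have [||y [Ey y_neq0]] := exists_orthogonal_nonisotropic (E := E) isT symM unitM.
- by rewrite orthoE unitmx1.
- exact: ltnSn.
pose P : 'M_(1 + n) := col_mx y E; exists P.
have gramP : P *m M *m P^T = block_mx (y *m M *m y^T) 0 0 1%:M.
  by rewrite gram_col_mx // orthoE.
have detP : \det P * \det P = (y *m M *m y^T) 0 0.
  have := congr1 determinant gramP.
  rewrite !det_mulmx det_tr detM mulr1 (@det_ublock _ 1 n) det1 mulr1 => ->.
  by rewrite [in LHS](mx11_scalar (y *m M *m y^T)) det_scalar1.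
have {}y_neq0 : \det P != 0.
  by apply: contraNneq y_neq0 => P0; rewrite -detP P0 mul0r.
rewrite gramP [y *m _ *m _]mx11_scalar -detP F3_sqr1 //.
by rewrite -scalar_mx_block.
Qed.

Lemma F3_natr k l : k = l %[mod 3] -> k%:R = l%:R :> 'F_3.
Proof.
move=> eq_kl; have F3_3 : 3%:R = 0 :> 'F_3 by apply/eqP.
rewrite (divn_eq k 3) (divn_eq l 3) eq_kl !natrD !natrM.
by rewrite F3_3 !mulr0 !add0r.
Qed.

(** * Values of the form, and reflections as matrices *)

Section SymmetricForm.

Variables (n : nat) (b : {symmetric 'rV['F_3]_n}).

Let M := matrix_of_form b.

Lemma formE u v : b u v = (u *m M *m v^T) 0 0.
Proof.
by rewrite -matrix_of_formK /form_of_matrix trace_mx11 map_mx_id.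
Qed.

Lemma formC u v : b u v = b v u.
Proof. by rewrite [LHS]hermC /= expr0 mul1r. Qed.

Lemma trmx_form : M^T = M.
Proof. by apply/matrixP=> i j; rewrite mxE !matrix_of_formE; apply: formC. Qed.

Lemma formDl u v w : b (u + v) w = b u w + b v w.
Proof. by rewrite linearDl. Qed.

Lemma formBl u v w : b (u - v) w = b u w - b v w.
Proof. by rewrite linearBl. Qed.

Lemma formBr u v w : b u (v - w) = b u v - b u w.
Proof. by rewrite !(formC u) formBl. Qed.

Lemma formZl a u v : b (a *: u) v = a * b u v.
Proof. by rewrite linearZl_LR. Qed.

Lemma formZr a u v : b u (a *: v) = a * b u v.
Proof. by rewrite !(formC u) formZl. Qed.

Lemma form0l v : b 0 v = 0.
Proof. by rewrite linear0l. Qed.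

Lemma form_root v : quadf b v = 1 -> b v v = -1.
Proof.
by rewrite /quadf; case: (F3_cases (b v v)) => -> //; rewrite ?mulr0.
Qed.

(** As [b v v = -1], the coefficient of [v] is -2 [b x v], which is [b x v] modulo 3. *)
Lemma refl_root v x : quadf b v = 1 -> refl_fun b v x = x - b x v *: v.
Proof.
move=> v1; rewrite /refl_fun; set c := 2 * _ / _.
suff -> : c = b x v by [].
by rewrite {}/c form_root //; case: (F3_cases (b x v)) => ->; apply/eqP.
Qed.

Lemma refl_mulmx v x :
  quadf b v = 1 -> refl_fun b v x = x *m (1%:M - M *m v^T *m v).
Proof.
move=> v1; rewrite refl_root // mulmxBr mulmx1 !mulmxA.
by rewrite [x *m _ *m _]mx11_scalar -formE mul_scalar_mx.
Qed.

Lemma scalarsP (z : {perm 'rV['F_3]_n}) :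
  z \in scalars n -> exists a : 'F_3, forall x, z x = a *: x.
Proof.
case/cycleP=> k ->; elim: k => [|k [a IH]].
  by exists 1 => x; rewrite expg0 perm1 scale1r.
by exists (- a) => x; rewrite expgSr permM IH permE scaleNr.
Qed.

End SymmetricForm.

(** Used for an isomorphism and for its inverse, this reduces an abstract copy of the group to
    [POpp b]. *)
Lemma transposition_embedding_morphim (aT rT : finGroupType) (G : {group aT})
    (D : {set aT}) (h : {morphism G >-> rT}) m :
    ('injm h)%g -> transposition_embedding G D m ->
  transposition_embedding (h @* G)%G (h @* D)%g m.
Proof.
move=> inj_h [f [inj_f fG fD]].
have mem_f s : f s \in G by apply: (subsetP fG); rewrite mem_morphim ?inE.
have hfM : {in [set: 'S_m] &, {morph h \o f : s t / (s * t)%g}}.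
  by move=> s t _ _; rewrite /= !morphM ?inE.
exists (Morphism hfM); split=> [||i j ne_ij] /=.
- apply/injmP=> s t _ _ /= eq_hf.
  by apply: (injmP inj_f); rewrite ?inE //; apply: (injmP inj_h).
- by apply/subsetP=> _ /morphimP[s _ _ ->] /=; rewrite mem_morphim.
- by rewrite mem_morphim // fD.
Qed.

(** * Upper bound: roots of adjacent transpositions and their Gram determinant *)

Section UpperBound.

Variables (n : nat) (b : {symmetric 'rV['F_3]_n}).

Let M := matrix_of_form b.

Lemma mem_norm_scalars v :
  quadf b v = 1 -> reflection b v \in ('N(scalars n))%g.
Proof.
move=> v1; apply: (subsetP (Opp_norm_scalars b)).
by apply: mem_gen; apply/imsetP; exists v; rewrite ?inE ?v1.
Qed.

Lemma PreflectionsP x :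
  reflect (exists2 v, quadf b v = 1 & x = coset (scalars n) (reflection b v))
          (x \in Preflections b).
Proof.
apply: (iffP idP) => [/morphimP[_ _ /imsetP[v v1 ->] ->]|[v v1 ->]].
  by exists v => //; move: v1; rewrite inE => /eqP.
apply: mem_morphim; first exact: mem_norm_scalars.
by apply/imsetP; exists v; rewrite ?inE ?v1.
Qed.

Lemma exists_orthogonal2 u v :
  (2 < n)%N -> exists x, [/\ x != 0, b x u = 0 & b x v = 0].
Proof.
move=> lt2n; pose K := kermx (M *m (col_mx u v)^T).
have /rowV0Pn[x /sub_kermxP xK x_neq0] : K != 0.
  rewrite -mxrank_eq0 mxrank_ker subn_eq0 -ltnNge.
  by rewrite (leq_ltn_trans (rank_leq_col _)).
exists x; have := xK; rewrite tr_col_mx mulmxA mul_mx_row => /eqP.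
rewrite row_mx_eq0 => /andP[/eqP xu /eqP xv].
by rewrite !formE xu xv mxE.
Qed.

Lemma commute_orthogonal_reflections u v :
    quadf b u = 1 -> quadf b v = 1 -> b u v = 0 ->
  commute (reflection b u) (reflection b v).
Proof.
move=> u1 v1 uv0; have vu0 : b v u = 0 by rewrite formC.
apply/permP=> x; rewrite !permM !permE !refl_root // !formBl !formZl uv0 vu0.
by rewrite !mulr0 !subr0 addrAC.
Qed.

(* The commutator of the two reflections is a scalar that fixes a nonzero vector
   orthogonal to both roots, so it is trivial. *)
Lemma commute_Preflections u v :
    (2 < n)%N -> quadf b u = 1 -> quadf b v = 1 ->
    commute (coset (scalars n) (reflection b u))
            (coset (scalars n) (reflection b v)) ->
  b u v = 0 \/ reflection b u = reflection b v.
Proof.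
move=> lt2n u1 v1; set ru := reflection b u; set rv := reflection b v.
have [Nu Nv] := (mem_norm_scalars u1, mem_norm_scalars v1).
rewrite /commute -!morphM //= => /kercoset_rcoset[||z]; rewrite ?groupM //.
case/scalarsP=> a za eq_uv.
have reflE w x : quadf b w = 1 -> reflection b w x = x - b x w *: w.
  by move=> w1; rewrite permE refl_root.
have [x [x_neq0 xu xv]] := exists_orthogonal2 u v lt2n.
have a1 : a = 1.
  move/permP/(_ x): eq_uv; rewrite !permM za !reflE // !formBl !formZl xu xv.
  rewrite !(mulr0, mul0r, subr0, scale0r) => eq_ax.
  have /eqP : (a - 1) *: x = 0 by rewrite scalerBl scale1r -eq_ax subrr.
  by rewrite scaler_eq0 (negPf x_neq0) orbF subr_eq0 => /eqP.
move/permP/(_ v): eq_uv; rewrite !permM za a1 scale1r !reflE //.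
rewrite !formBl !formZl !form_root // (formC b v u).
have [->|uv_neq0] := eqVneq (b u v) 0; [by left | right].
(* With c = [b u v], the values of the two products at [v] differ by c u + c^2 v, and c is
   nonzero. *)
have uE : u = - b u v *: v.
  apply/rowP=> i; move/rowP/(_ i): eq_uv; rewrite !mxE.
  move: (b u v) uv_neq0 (u 0 i) (v 0 i) => c c_neq0 p q.
  by case: (F3_cases c) c_neq0 => -> //; case: (F3_cases p) => ->;
    case: (F3_cases q) => -> _ /eqP //= _; apply/eqP.
have sqr_uv : - b u v * - b u v = 1 by rewrite mulrNN F3_sqr1.
apply/permP=> y; rewrite !reflE // [in LHS]uE formZr scalerA.
by rewrite mulrAC sqr_uv mul1r.
Qed.

(** Injectivity preserves both facts about adjacent transpositions: overlapping ones do not commute,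
    so their roots are not orthogonal; disjoint ones commute and are distinct, so their roots are
    orthogonal. *)
Lemma tridiagonal_roots m k :
    (2 < n)%N -> transposition_embedding (POpp b) (Preflections b) m ->
    (k < m)%N ->
  exists v : 'I_k -> 'rV['F_3]_n,
    [/\ forall i, quadf b (v i) = 1,
        forall i j : 'I_k, j = i.+1 :> nat -> b (v i) (v j) != 0
      & forall i j : 'I_k, (i.+1 < j)%N -> b (v i) (v j) = 0].
Proof.
move=> lt2n [f [inj_f fG fD]] lt_km.
(* The values of [p i] and [q i] are [i] and [i.+1]; for [q] this is read off from the bound, as
   [i < k] unfolds to [i.+1 <= k]. *)
pose p (i : 'I_k) : 'I_m := Ordinal (ltn_trans (ltn_ord i) lt_km).
pose q (i : 'I_k) : 'I_m := Ordinal (leq_ltn_trans (ltn_ord i) lt_km).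
have neq_pq i : p i != q i by rewrite -val_eqE /= neq_ltn ltnSn.
have f_eq s t : f s = f t -> s = t.
  by move=> eq_f; apply: (injmP inj_f); rewrite ?inE.
have fM s t : f (s * t)%g = (f s * f t)%g by rewrite morphM ?inE.
have /fin_all_exists[v vP] (i : 'I_k) : exists v, quadf b v = 1
    /\ f (tperm (p i) (q i)) = coset (scalars n) (reflection b v).
  by case/PreflectionsP: (fD _ _ (neq_pq i)) => v; exists v.
exists v; split=> [i|i j eq_ji|i j lt_ij]; first by case: (vP i).
  have [[vi1 fi] [vj1 fj]] := (vP i, vP j).
  apply/eqP=> /(commute_orthogonal_reflections vi1 vj1) comm_ij.
  have eq_qp : p j = q i by apply: val_inj.
  have: (tperm (p i) (q i) * tperm (p j) (q j))%g
      = (tperm (p j) (q j) * tperm (p i) (q i))%g.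
    apply: f_eq; rewrite !fM fi fj -!morphM ?mem_norm_scalars //=.
    by rewrite comm_ij.
  have fix_pi : tperm (p j) (q j) (p i) = p i.
    by rewrite tpermD // -val_eqE /= eq_ji; lia.
  (* At [p i] one product takes the value [q j], the other [p j]. *)
  move/permP/(_ (p i)); rewrite !permM fix_pi tpermL -eq_qp tpermL.
  by move/eqP; rewrite eq_sym (negPf (neq_pq j)).
have [[vi1 fi] [vj1 fj]] := (vP i, vP j).
have [fix_p fix_q] : tperm (p j) (q j) (p i) = p i
    /\ tperm (p j) (q j) (q i) = q i.
  by split; rewrite tpermD // -val_eqE /=; lia.
case: (commute_Preflections lt2n vi1 vj1) => //.
  rewrite -fi -fj /commute -!fM; congr (f _).
  by apply/commgP/conjg_fixP; rewrite tpermJ fix_p fix_q.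
move=> eq_r; have := f_eq (tperm (p i) (q i)) (tperm (p j) (q j)).
rewrite fi fj eq_r => /(_ erefl)/permP/(_ (p i)); rewrite fix_p tpermL.
by move/eqP; rewrite eq_sym (negPf (neq_pq i)).
Qed.

(** The signs of adjacent products are unknown, but only their squares matter, and these are 1; the
    diagonal entries -1 are 2 in F_3. *)
Lemma gram_roots_det k (v : 'I_k -> 'rV['F_3]_n) :
    (forall i, quadf b (v i) = 1) ->
    (forall i j : 'I_k, j = i.+1 :> nat -> b (v i) (v j) != 0) ->
    (forall i j : 'I_k, (i.+1 < j)%N -> b (v i) (v j) = 0) ->
  \det (\matrix_i v i *m M *m (\matrix_i v i)^T) = k.+1%:R.
Proof.
move=> v1 v_adj v_far.
have entry i j : (\matrix_i v i *m M *m (\matrix_i v i)^T) i j = b (v i) (v j).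
  by rewrite gramE !rowK formE.
apply: det_tridiag => [i|i j eq_ji|i j lt_ij]; rewrite !entry.
- by rewrite form_root //; apply/eqP.
- by rewrite (formC b (v j)) F3_sqr1 // v_adj.
- by rewrite (formC b (v j)) v_far.
Qed.

(** A larger [m] would give as many roots as the bound says. For n = 1 mod 3, the determinant n + 1
    = 2 of n roots is not a square; otherwise n + 2 is nonzero mod 3, so n + 1 roots would have an
    invertible Gram matrix of rank at most n. *)
Lemma transposition_embedding_bound m :
    (2 < n)%N -> \det M = 1 ->
    transposition_embedding (POpp b) (Preflections b) m ->
  (m <= if (n %% 3 == 1)%N then n else n.+1)%N.
Proof.
move=> lt2n detM emb; rewrite leqNgt; apply/negP=> lt_m.
have [v [v1 v_adj v_far]] := tridiagonal_roots lt2n emb lt_m.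
have := gram_roots_det v1 v_adj v_far.
case: ifP v v1 v_adj v_far {lt_m} => [/eqP n_mod3|n_mod3] v _ _ _ detG.
  have n1 : n.+1%:R = 2%:R :> 'F_3.
    by apply: F3_natr; rewrite -addn1 -modnDml n_mod3.
  move: detG; rewrite n1 !det_mulmx det_tr detM mulr1.
  by case: (F3_cases (\det (\matrix_i v i))) => -> /eqP.
have: \rank (\matrix_i v i *m M *m (\matrix_i v i)^T) = n.+1.
  apply: mxrank_unit; rewrite unitmxE detG unitfE.
  have -> : n.+2%:R = ((n %% 3 + 2) %% 3)%:R :> 'F_3.
    by apply: F3_natr; rewrite modn_mod modnDml addn2.
  by case: (n %% 3)%N (ltn_pmod n (isT : 0 < 3)%N) n_mod3 => [|[|[|]]].
apply/eqP; rewrite neq_ltn ltnS -mulmxA.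
by rewrite (leq_trans (mxrankM_maxl _ _)) ?rank_leq_col.
Qed.

End UpperBound.

(** * Lower bound: symmetric groups permuting points up to translation *)

Section LowerBound.

Variables (n : nat) (b : {symmetric 'rV['F_3]_n}).

Let M := matrix_of_form b.

(** The terms [a i] and [a j] cancel in the norm of the difference, leaving 2 = -1. *)
Lemma root_difference m (w : 'I_m -> 'rV['F_3]_n) (a : 'I_m -> 'F_3) i j :
    (forall i j, b (w i) (w j) = (i == j)%:R + a i + a j) -> i != j ->
  quadf b (w i - w j) = 1.
Proof.
move=> gram ne_ij; rewrite /quadf !(formBl, formBr) !gram !eqxx (eq_sym j).
rewrite (negPf ne_ij) /=; set d := _ - _.
suff -> : d = 2%:R by apply/eqP.
by rewrite /d; ring.
Qed.

(* The reflection in [w i - w j] permutes the points [w k] up to a common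
   translation, because of the additive shape of their Gram matrix. *)
Lemma transposition_embedding_simplex m (w : 'I_m.+1 -> 'rV['F_3]_n) (c : 'F_3) :
    (3 <= m)%N ->
    (forall i j, b (w i) (w j)
       = (i == j)%:R + c * (i == ord0)%:R + c * (j == ord0)%:R) ->
    (forall A B : 'M_n, (forall k, w k *m A = w k *m B) -> A = B) ->
  transposition_embedding (POpp b) (Preflections b) m.+1.
Proof.
move=> le3m gram w_full.
have root_w i j : i != j -> quadf b (w i - w j) = 1.
  exact: (root_difference (a := fun i => c * (i == ord0)%:R)).
have form_diff i j k : b (w k) (w i - w j)
    = (k == i)%:R - (k == j)%:R + c * ((i == ord0)%:R - (j == ord0)%:R).
  by rewrite formBr !gram; ring.
have form_diff2 p q i j : b (w p - w q) (w i - w j)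
    = (p == i)%:R - (p == j)%:R - ((q == i)%:R - (q == j)%:R).
  by rewrite formBl !form_diff; ring.
(* By [w_full] at most one matrix acts as a given [s]; this makes the choice of [g s] below
   multiplicative. *)
pose acts (s : 'S_m.+1) (A : 'M_n) :=
  forall k, w k *m A = w (s k) + c *: (w (s ord0) - w ord0).
have acts_mul s t A B : acts s A -> acts t B -> acts (s * t)%g (A *m B).
  move=> sA tB k.
  have diffB p q : (w p - w q) *m B = w (t p) - w (t q).
    by rewrite mulmxBl !tB opprD addrACA subrr addr0.
  rewrite mulmxA sA mulmxDl -scalemxAl diffB tB !permM -addrA -scalerDr.
  by rewrite (addrC (w (t ord0) - _)) addrA subrK.
have acts_tperm i j : i != j ->
    acts (tperm i j) (1%:M - M *m (w i - w j)^T *m (w i - w j)).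
  move=> ne_ij k; rewrite -refl_mulmx ?root_w // refl_root ?root_w // form_diff.
  set r := w i - w j; set d := (i == ord0)%:R - _.
  (* The Kronecker part of [form_diff] yields the transposition, the part [c * d] the
     translation. *)
  have tw l : w (tperm i j l) = w l - ((l == i)%:R - (l == j)%:R) *: r.
    case: tpermP => [->|->|/eqP/negPf-> /eqP/negPf->].
    - by rewrite eqxx (negPf ne_ij) subr0 scale1r /r opprB addrC subrK.
    - by rewrite eqxx eq_sym (negPf ne_ij) sub0r scaleN1r opprK /r addrC subrK.
    - by rewrite subrr scale0r subr0.
  rewrite !tw (addrAC (w ord0)) subrr add0r !(eq_sym ord0) -/d.
  by rewrite scalerN scalerA scalerDl opprD addrA.
have acts_inj s A B : acts s A -> acts s B -> A = B.
  by move=> sA sB; apply: w_full => k; rewrite sA sB.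
have acts1 : acts 1%g 1%:M.
  by move=> k; rewrite mulmx1 !perm1 subrr scaler0 addr0.
(* A decomposition of [s] into transpositions gives a product of reflections together with its
   matrix. *)
have /fin_all_exists[gA gAP] (s : 'S_m.+1) : exists gA : {perm _} * 'M_n,
    [/\ gA.1 \in Opp b, forall x, gA.1 x = x *m gA.2 & acts s gA.2].
  have [ts -> dpair_ts] := prod_tpermP s; elim: ts dpair_ts => /= [_|[i j] ts IH].
    exists (1%g, 1%:M); rewrite big_nil group1; split=> // x.
    by rewrite perm1 mulmx1.
  case/andP=> ne_ij /IH[[g A] /= [gO gA sA]]; rewrite big_cons.
  exists (reflection b (w i - w j) * g,
    (1%:M - M *m (w i - w j)^T *m (w i - w j)) *m A)%g; split=> [|x|] /=.
  - rewrite groupM // mem_gen //; apply/imsetP; exists (w i - w j) => //.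
    by rewrite inE root_w.
  - by rewrite permM permE gA refl_mulmx ?root_w // mulmxA.
  - by apply: acts_mul sA; apply: acts_tperm.
pose g (s : 'S_m.+1) := (gA s).1.
have gO s : g s \in Opp b by case: (gAP s).
have gN s : g s \in ('N(scalars n))%g by apply: (subsetP (Opp_norm_scalars b)).
have gE s A : acts s A -> forall x, g s x = x *m A.
  have [_ gsE s_gA] := gAP s.
  by move=> sA x; rewrite [LHS]gsE (acts_inj _ _ _ s_gA sA).
have gw s k : g s (w k) = w (s k) + c *: (w (s ord0) - w ord0).
  by have [_ gsE s_gA] := gAP s; rewrite [LHS]gsE.
have gM s t : g (s * t)%g = (g s * g t)%g.
  have [_ gsE s_gA] := gAP s; have [_ gtE t_gA] := gAP t.
  apply/permP=> x; rewrite permM (gE _ _ (acts_mul _ _ _ _ s_gA t_gA)).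
  by rewrite (gE _ _ s_gA) (gE _ _ t_gA) mulmxA.
pose f (s : 'S_m.+1) := coset (scalars n) (g s).
have fM : {in [set: 'S_m.+1] &, {morph f : s t / (s * t)%g}}.
  by move=> s t _ _; rewrite /f gM; apply: morphM; apply: gN.
have g_tperm i j : i != j -> g (tperm i j) = reflection b (w i - w j).
  move=> ne_ij; apply/permP=> x; rewrite (gE _ _ (acts_tperm _ _ ne_ij)).
  by rewrite permE refl_mulmx ?root_w.
exists (Morphism fM); split=> [||i j ne_ij] /=.
- apply/subsetP=> s /morphpreP[_ /set1P fs1]; apply/set1P/permP=> i.
  have [a gs] := scalarsP (coset_idr (gN s) fs1).
  (* There are at least four indices because [3 <= m]. *)
  have fresh (xs : seq 'I_m.+1) : (size xs <= 3)%N -> exists j, j \notin xs.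
    move=> le_xs; apply/existsP; rewrite -negb_forall.
    apply: contraL (leq_trans le_xs le3m) => /forallP all_xs.
    rewrite -ltnNge; apply: leq_trans (card_size xs).
    rewrite -[X in (X <= _)%N]card_ord.
    by apply/subset_leq_card/subsetP=> x _; apply: all_xs.
  rewrite perm1; apply/eqP; apply: contraT => ne_si.
  have [j] := fresh [:: i; s i] isT; rewrite !inE negb_or => /andP[ne_ji ne_jsi].
  have [l] := fresh [:: i; j; s i] isT.
  rewrite !inE !negb_or => /and3P[ne_li ne_lj ne_lsi].
  have: w (s i) - w (s j) = a *: (w i - w j).
    by rewrite scalerBr -!gs !gw opprD addrACA subrr addr0.
  (* The right side pairs to 0, as [i] and [j] differ from [s i] and [l]; the left side pairs to 1
     or 2. *)
  move/(congr1 (fun u => b u (w (s i) - w l))).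
  rewrite formZl !form_diff2 eqxx (inj_eq perm_inj) (eq_sym i) (negPf ne_si).
  rewrite (negPf ne_ji) (negPf ne_jsi) !(eq_sym _ l) (negPf ne_li) (negPf ne_lj).
  rewrite (negPf ne_lsi) /= !subr0 mulr0 sub0r opprK => /eqP.
  by case: (l == s j).
- by apply/subsetP=> _ /morphimP[s _ _ ->]; exact: mem_morphim (gN s) (gO s).
- by rewrite /f g_tperm //; apply/PreflectionsP; exists (w i - w j);
    rewrite ?root_w.
Qed.

Lemma orthonormal_basis :
    \det M = 1 ->
  exists2 P : 'M_n,
    P \in unitmx & forall i j, b (row i P) (row j P) = (i == j)%:R.
Proof.
move=> detM; have [P orthoP] := orthonormal_matrix (trmx_form b) detM.
exists P => [|i j].
  by have [+ _] := mulmx1_unit orthoP; rewrite unitmx_mul => /andP[].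
by rewrite formE -gramE orthoP mxE.
Qed.

Lemma row_full_inj (P A B : 'M['F_3]_n) :
  P \in unitmx -> (forall i, row i P *m A = row i P *m B) -> A = B.
Proof.
move=> unitP eqAB; apply: (can_inj (mulKmx unitP)); apply/row_matrixP=> i.
by rewrite !row_mul.
Qed.

(* The points are an orthonormal basis and [c] times its sum. *)
Lemma transposition_embedding_bordered (c : 'F_3) :
    (2 < n)%N -> \det M = 1 -> c * (c * n%:R) = 1 + c + c ->
  transposition_embedding (POpp b) (Preflections b) n.+1.
Proof.
move=> lt2n /orthonormal_basis[P unitP orthoP] c_eq.
pose w k := oapp (fun i => row i P) (c *: \sum_i row i P) (unlift (@ord0 n) k).
have form_sum v : b (\sum_i row i P) v = \sum_i b (row i P) v.
  by apply: (big_morph (b^~ v)) => [x y|]; rewrite ?formDl ?form0l.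
have form_row j : b (\sum_i row i P) (row j P) = 1.
  rewrite form_sum (bigD1 j) //= orthoP eqxx big1 ?addr0 // => i ne_ij.
  by rewrite orthoP (negPf ne_ij).
apply: (transposition_embedding_simplex (w := w) (c := c)) => // [i j|A B eqAB].
  rewrite /w; case: (unliftP ord0 i) => [i' ->|->];
    case: (unliftP ord0 j) => [j' ->|->] /=.
  - by rewrite (inj_eq lift_inj) orthoP !mulr0 !addr0.
  - by rewrite formZr formC form_row mulr0 addr0 add0r.
  - by rewrite formZl form_row mulr0 addr0 add0r.
  (* The norm c^2 n of the extra point must be 1 + 2c, which is the hypothesis on [c]. *)
  rewrite !mulr1 -c_eq formZl formZr form_sum; congr (_ * (_ * _)).
  rewrite (eq_bigr (fun=> 1)) => [|k _]; last by rewrite formC form_row.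
  by rewrite sumr_const card_ord.
apply: (row_full_inj unitP) => i; have := eqAB (lift ord0 i).
by rewrite /w liftK.
Qed.

End LowerBound.

(** An orthonormal basis serves as the set of points, with c = 0 and no translations; [3 < n]
    provides the four points that injectivity modulo scalars uses. *)
Lemma transposition_embedding_coordinates n (b : {symmetric 'rV['F_3]_n}) :
    (3 < n)%N -> \det (matrix_of_form b) = 1 ->
  transposition_embedding (POpp b) (Preflections b) n.
Proof.
case: n b => // n b lt3n /orthonormal_basis[P unitP orthoP].
apply: (transposition_embedding_simplex (w := fun i => row i P) (c := 0)) => //.
  by move=> i j; rewrite orthoP !mul0r !addr0.
by move=> A B; apply: row_full_inj.
Qed.

Theorem proposition4 (n : nat) (b : {symmetric 'rV['F_3]_n})
    (gT : finGroupType) (G : {group gT}) (D : {set gT})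
    (h : {morphism POpp b >-> gT}) :
  (3 <= n)%N ->
  \det (matrix_of_form b) = 1 ->
  isom (POpp b) G h ->
  D = (h @* Preflections b)%g ->
  is_phi G D (if (n %% 3 == 1)%N then n else n.+1).
Proof.
move=> le3n detM /isomP[inj_h imG] ->.
have -> : G = (h @* POpp b)%G by apply: group_inj.
have sub_refl : (Preflections b \subset POpp b)%g.
  by apply: morphimS; apply: subset_gen.
split=> [|m emb]; last first.
  apply: transposition_embedding_bound le3n detM _.
  have := transposition_embedding_morphim (injm_invm inj_h) emb.
  rewrite morphim_invm //.
  suff -> : (invm inj_h @* (h @* POpp b))%G = POpp b by [].
  by apply: group_inj; apply: im_invm.
apply: transposition_embedding_morphim => //.
case: ifP => [/eqP n_mod3|n_mod3].
  apply: transposition_embedding_coordinates => //.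
  (* The residue 1 excludes n = 3. *)
  by case: n le3n n_mod3 {b detM h inj_h imG sub_refl} => [|[|[|[|]]]].
have [n_mod|n_mod] : (n %% 3 = 0)%N \/ (n %% 3 = 2)%N.
  by case: (n %% 3)%N (ltn_pmod n (isT : 0 < 3)%N) n_mod3 => [|[|[|]]] //; [left | right].
(* The equation c^2 n = 1 + 2c becomes 0 = 3 for n = 0 and c = 1, and 2 = -1 for n = 2 and c = -1;
   both hold in F_3. *)
- apply: (transposition_embedding_bordered (c := 1)) => //.
  by rewrite (@F3_natr n 0) ?n_mod //; apply/eqP.
- apply: (transposition_embedding_bordered (c := -1)) => //.
  by rewrite (@F3_natr n 2) ?n_mod //; apply/eqP.
Qed.
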